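(* Let $k$ be an algebraically closed field of characteristic $p>0$, let $\mathfrak{e}_r$ be the $r$-dimensional elementary restricted Lie algebra over $k$, and let $M$ be a finite-dimensional $\mathrm{GL}_r(k)$-stable $U_0(\mathfrak{e}_r)$-module. If $j\in\{1,\ldots,p-1\}$ is such that the morphism $\mathrm{im}^j_M:\mathbb{P}(\mathfrak{e}_r)\to\mathrm{Gr}_{\mathrm{rk}^j(M)}(M)$, $[x]\mapsto\mathrm{im}\,x_M^j$, is not constant, then $\mathrm{im}^j_M$ is injective.
   Context: $\mathfrak{e}_r$ is the $r$-dimensional abelian Lie algebra with zero $p$-map; its restricted enveloping algebra is $U_0(\mathfrak{e}_r)\cong k[X_1,\ldots,X_r]/(X_1^p,\ldots,X_r^p)$. $\mathrm{GL}_r(k)=\mathrm{GL}(\mathfrak{e}_r)$ acts on $\mathfrak{e}_r$ by automorphisms of restricted Lie algebras and hence on $U_0(\mathfrak{e}_r)$ by automorphisms of Hopf algebras. For a $U_0(\mathfrak{e}_r)$-module $M$ and $g\in\mathrm{GL}_r(k)$, $M^{(g)}$ is the module with underlying space $M$ and action $u.m:=(g^{-1}.u)m$; $M$ is $\mathrm{GL}_r(k)$-stable if $M^{(g)}\cong M$ for all $g\in\mathrm{GL}_r(k)$. For $x\in\mathfrak{e}_r$, $x_M$ is the operator $m\mapsto x.m$. A $\mathrm{GL}_r(k)$-stable module has constant $j$-rank, i.e. $\mathrm{rk}(x_M^j)$ has the same value, denoted $\mathrm{rk}^j(M)$, for all $x\in\mathfrak{e}_r\setminus\{0\}$, so $\mathrm{im}^j_M$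 is defined on all of $\mathbb{P}(\mathfrak{e}_r)$; it takes values in the Grassmannian of $\mathrm{rk}^j(M)$-dimensional subspaces of $M$. *)

(* Defs.v *)
From HB Require Import structures.
From mathcomp Require Import all_boot all_order all_algebra.
From mathcomp Require Import generic_quotient ring_quotient.
From mathcomp Require Import mpoly.
From mathcomp Require boolp.

Set Implicit Arguments.
Unset Strict Implicit.
Unset Printing Implicit Defensive.

Import GRing.Theory.
Local Open Scope ring_scope.
Local Open Scope quotient_scope.

Section RestrictedEnvelopingAlgebra.

Variables (k : fieldType) (p : nat) (hp : p \in [pchar k]) (r : nat).

(* The ideal (X_1^p, ..., X_r^p) of k[X_1, ..., X_r]; hp is an argument because
   properness of the ideal needs p > 0. *)
Definition trunc_ideal of p \in [pchar k] : {pred {mpoly k[r]}} :=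
  fun q => boolp.asbool
    (exists a : 'I_r -> {mpoly k[r]}, q = \sum_i a i * 'X_i ^+ p).

Lemma trunc_idealP (q : {mpoly k[r]}) :
  reflect (exists a : 'I_r -> {mpoly k[r]}, q = \sum_i a i * 'X_i ^+ p)
          (q \in trunc_ideal hp).
Proof. exact: boolp.asboolP. Qed.

Lemma trunc_ideal_closed : idealr_closed (trunc_ideal hp).
Proof.
split.
- by apply/trunc_idealP; exists (fun=> 0); rewrite big1 // => i _; rewrite mul0r.
- apply/negP => /trunc_idealP[a /(congr1 (meval (fun=> 0)))].
  rewrite rmorph1 raddf_sum /= big1 => [/eqP|i _]; first by rewrite oner_eq0.
  rewrite rmorphM rmorphXn /= mevalXU expr0n.
  by rewrite (gtn_eqF (prime_gt0 (pcharf_prime hp))) mulr0.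
- move=> b _ _ /trunc_idealP[a1 ->] /trunc_idealP[a2 ->]; apply/trunc_idealP.
  exists (fun i => b * a1 i + a2 i).
  by rewrite mulr_sumr -big_split; apply: eq_bigr => i _; rewrite mulrDl mulrA.
Qed.

HB.instance Definition _ :=
  isIdealr.Build {mpoly k[r]} (trunc_ideal hp) trunc_ideal_closed.

Definition U0 : Type := {ideal_quot (trunc_ideal hp : idealr _)}.

HB.instance Definition _ := GRing.ComNzRing.on U0.

Definition U0proj (q : {mpoly k[r]}) : U0 :=
  \pi_({ideal_quot (trunc_ideal hp : idealr _)}) q.

Definition U0repr (u : U0) : {mpoly k[r]} :=
  repr (u : {ideal_quot (trunc_ideal hp : idealr _)}).

Lemma U0reprK : cancel U0repr U0proj.
Proof. exact: reprK. Qed.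

Lemma U0projB : zmod_morphism U0proj.
Proof. exact: rmorphB. Qed.

Lemma U0projM : monoid_morphism U0proj.
Proof. by split; [exact: rmorph1 | exact: rmorphM]. Qed.

HB.instance Definition _ :=
  GRing.isZmodMorphism.Build {mpoly k[r]} U0 U0proj U0projB.
HB.instance Definition _ :=
  GRing.isMonoidMorphism.Build {mpoly k[r]} U0 U0proj U0projM.

Lemma U0proj_eq q1 q2 :
  (U0proj q1 == U0proj q2) = (q1 - q2 \in trunc_ideal hp).
Proof. by rewrite [RHS]Quotient.idealrBE. Qed.

Definition U0scale (c : k) (u : U0) : U0 := U0proj c%:MP * u.

Fact U0scaleA a b u : U0scale a (U0scale b u) = U0scale (a * b) u.
Proof. by rewrite /U0scale mulrA mpolyCM rmorphM. Qed.
Fact U0scale1 : left_id 1 U0scale.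
Proof. by move=> u; rewrite /U0scale mpolyC1 rmorph1 mul1r. Qed.
Fact U0scaleDr : right_distributive U0scale +%R.
Proof. by move=> a u v; rewrite /U0scale mulrDr. Qed.
Fact U0scaleDl u : {morph U0scale^~ u : a b / a + b}.
Proof. by move=> a b; rewrite /U0scale mpolyCD rmorphD mulrDl. Qed.
HB.instance Definition _ := GRing.Zmodule_isLmodule.Build k U0
  U0scaleA U0scale1 U0scaleDr U0scaleDl.
Fact U0scaleAl (a : k) (u v : U0) : a *: (u * v) = a *: u * v.
Proof. by rewrite /GRing.scale /= /U0scale mulrA. Qed.
HB.instance Definition _ := GRing.Lmodule_isLalgebra.Build k U0 U0scaleAl.
HB.instance Definition _ := GRing.Lalgebra_isComAlgebra.Build k U0.

Lemma U0projZ : scalable U0proj.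
Proof. by move=> c q; rewrite -mul_mpolyC rmorphM. Qed.

HB.instance Definition _ :=
  GRing.isScalable.Build k {mpoly k[r]} U0 *:%R U0proj U0projZ.

(* The underlying vector space of e_r; the bracket and the p-map are zero. *)
Definition elemLie : vectType k := 'cV[k]_r.

Definition lie_incl (x : elemLie) : U0 := U0proj (\sum_i x i 0 *: 'X_i).

(* The algebra endomorphism of k[X_1, ..., X_r] sending X_j = e_j to g e_j. *)
Definition GLsubst (g : 'M[k]_r) (q : {mpoly k[r]}) : {mpoly k[r]} :=
  q \mPo [tuple \sum_i g i j *: 'X_i | j < r].

(* GLact_proj below shows that the choice of representative is immaterial. *)
Definition GLact (g : 'M[k]_r) (u : U0) : U0 := U0proj (GLsubst g (U0repr u)).

Lemma GLsubst_ideal g q :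
  q \in trunc_ideal hp -> GLsubst g q \in trunc_ideal hp.
Proof.
have hpX : p \in [pchar {mpoly k[r]}] := rmorph_pchar (@mpolyC r k) hp.
case/trunc_idealP=> a ->; rewrite /GLsubst raddf_sum /=.
apply: rpred_sum => j _; rewrite rmorphM rmorphXn /= comp_mpolyXU.
rewrite -tnth_nth tnth_mktuple; apply: idealMr.
rewrite -(pFrobenius_autE hpX) rmorph_sum; apply: rpred_sum => i _ /=.
rewrite pFrobenius_autE exprZn -mul_mpolyC; apply: idealMr.
apply/trunc_idealP; exists (fun l => (l == i)%:R).
rewrite (bigD1 i) //= eqxx mul1r big1 ?addr0 // => l /negPf->.
by rewrite mul0r.
Qed.

Lemma GLact_proj g q : GLact g (U0proj q) = U0proj (GLsubst g q).
Proof.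
apply/eqP; rewrite U0proj_eq -raddfB; apply: GLsubst_ideal.
by rewrite -U0proj_eq U0reprK.
Qed.

Lemma GLact_linear g : linear (GLact g).
Proof.
move=> c u v; rewrite -[u]U0reprK -[v]U0reprK -linearP !GLact_proj.
by rewrite /GLsubst !linearP.
Qed.

Lemma GLact1 g : GLact g 1 = 1.
Proof. by rewrite -(rmorph1 U0proj) GLact_proj /GLsubst comp_mpoly1. Qed.

Lemma GLactM g : {morph GLact g : u v / u * v}.
Proof.
move=> u v; rewrite -[u]U0reprK -[v]U0reprK -rmorphM !GLact_proj.
by rewrite /GLsubst !rmorphM.
Qed.

Lemma GLact_incl g (x : elemLie) :
  GLact g (lie_incl x) = lie_incl (g *m x : 'cV[k]_r).
Proof.
rewrite GLact_proj; congr U0proj; rewrite /GLsubst raddf_sum /=.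
under eq_bigr => j _ do
  rewrite comp_mpolyZ comp_mpolyXU -tnth_nth tnth_mktuple scaler_sumr.
rewrite exchange_big; apply: eq_bigr => i _ /=.
by rewrite mxE scaler_suml; apply: eq_bigr => j _; rewrite scalerA mulrC.
Qed.

Record U0module := U0Module {
  U0carrier :> vectType k;
  U0act : U0 -> 'End(U0carrier);
  U0act_linear : linear U0act;
  U0act1 : U0act 1 = \1%VF;
  U0actM : forall u v, U0act (u * v) = (U0act u \o U0act v)%VF }.

Definition U0iso (M N : U0module) : Prop :=
  exists f : {linear M -> N},
    bijective f /\ forall (u : U0) (m : M), f (U0act M u m) = U0act N u (f m).

Section Twist.
Variables (M : U0module) (g : 'M[k]_r).

Definition twist_act (u : U0) : 'End(M) := U0act M (GLact (invmx g) u).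

Fact twist_act_linear : linear twist_act.
Proof. by move=> c u v; rewrite /twist_act GLact_linear U0act_linear. Qed.
Fact twist_act1 : twist_act 1 = \1%VF.
Proof. by rewrite /twist_act GLact1 U0act1. Qed.
Fact twist_actM u v : twist_act (u * v) = (twist_act u \o twist_act v)%VF.
Proof. by rewrite /twist_act GLactM U0actM. Qed.

Definition twist : U0module :=
  U0Module twist_act_linear twist_act1 twist_actM.
End Twist.

Definition GLstable (M : U0module) : Prop :=
  forall g : 'M[k]_r, g \in unitmx -> U0iso (twist M g) M.

Definition lie_op (M : U0module) (x : elemLie) : 'End(M) :=
  U0act M (lie_incl x).

Definition lfun_exp (V : vectType k) (f : 'End(V)) (j : nat) : 'End(V) :=
  iter j (comp_lfun f) \1%VF.

Definition im_pow (M : U0module) (j : nat) (x : elemLie) : {vspace M} :=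
  limg (lfun_exp (lie_op M x) j).

Definition Gr (V : vectType k) (d : nat) : Type :=
  {W : {vspace V} | \dim W == d}.

Definition Proj (V : vectType k) : Type := Gr V 1.

(* The common value of rk (x_M^j) over x != 0 when M is GL_r(k)-stable
   (dim_im_pow); (1, ..., 1) is merely a sample vector, nonzero if r > 0. *)
Definition rkj (M : U0module) (j : nat) : nat :=
  \dim (im_pow M j (const_mx 1 : 'cV[k]_r)).

Lemma im_pow_GL (M : U0module) (g : 'M[k]_r) : GLstable M -> g \in unitmx ->
  exists2 f : 'End(M), lker f == 0%VS &
    forall j (x : elemLie), im_pow M j (g *m x : 'cV[k]_r) = (f @: im_pow M j x)%VS.
Proof.
move=> hM gU; have gU' : invmx g \in unitmx by rewrite unitmx_inv.
have [f [bij_f fE]] := hM _ gU'.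
have fE' (x : elemLie) (m : M) :
    f (lie_op M (g *m x : 'cV[k]_r) m) = lie_op M x (f m).
  have := fE (lie_incl x) m; rewrite /= /twist_act invmxK GLact_incl.
  exact.
have kf : lker (linfun f : 'End(M)) == 0%VS.
  by apply/lker0P => u v; rewrite !lfunE /=; exact: bij_inj.
have iE (x : elemLie) j :
    (linfun f \o lfun_exp (lie_op M (g *m x : 'cV[k]_r)) j)%VF =
    (lfun_exp (lie_op M x) j \o linfun f)%VF.
  elim: j => [|j IHj]; first by rewrite /= comp_lfun1r comp_lfun1l.
  rewrite /= -comp_lfunA -IHj !comp_lfunA; congr (_ \o _)%VF.
  by apply/lfunP => m; rewrite !comp_lfunE !lfunE /=.
have fs : limg (linfun f : 'End(M)) = fullv.
  apply/eqP; rewrite eqEdim subvf /=.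
  by rewrite limg_dim_eq // (eqP kf) capv0.
exists (linfun f)^-1%VF => [|j x].
  apply/lker0P; case: bij_f => h fK hK.
  have hE u : ((linfun f)^-1)%VF u = h u.
    by rewrite -{1}[u]hK -[f (h u)](lfunE f) lker0_lfunK.
  by move=> u v; rewrite !hE; exact: (can_inj hK).
rewrite /im_pow -[X in limg X](comp_lfun1l) -(lker0_compVf kf) -comp_lfunA iE.
by rewrite !limg_comp fs.
Qed.

Lemma GL_transitive (x y : 'cV[k]_r) : x != 0 -> y != 0 ->
  exists2 g : 'M[k]_r, g \in unitmx & g *m x = y.
Proof.
have P (z : 'cV[k]_r) : z != 0 ->
    exists2 A : 'M[k]_r, A \in unitmx & A *m pid_mx 1 = z.
  move=> z0; have rz : \rank z = 1%N.
    by apply/eqP; rewrite eqn_leq rank_leq_col lt0n mxrank_eq0.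
  have cE := mx11_scalar (row_ebase z); set c := row_ebase z 0 0 in cE.
  have c0 : c != 0.
    by have := row_ebase_unit z; rewrite cE unitmxE det_scalar1 unitfE.
  exists (c *: col_ebase z); first by rewrite unitmxZ ?unitfE ?col_ebase_unit.
  by rewrite -[RHS]mulmx_ebase rz cE mul_mx_scalar -scalemxAl.
case/P=> A uA <- /P[B uB <-]; exists (B *m invmx A).
  by rewrite unitmx_mul uB unitmx_inv.
by rewrite -mulmxA mulKmx.
Qed.

Lemma dim_im_pow (M : U0module) j (x : elemLie) :
  GLstable M -> x != 0 -> \dim (im_pow M j x) = rkj M j.
Proof.
move=> hM x0; have c0 : const_mx 1 != 0 :> 'cV[k]_r.
  apply: contraNneq x0 => c0; apply/eqP/matrixP => i l.
  by have /matrixP/(_ i l)/eqP := c0; rewrite !mxE oner_eq0.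
have [g gU <-] := GL_transitive c0 x0.
have [f kf ->] := im_pow_GL hM gU.
by rewrite limg_dim_eq // (eqP kf) capv0.
Qed.

Fact imj_subproof (M : U0module) (hM : GLstable M) j (L : Proj elemLie) :
  \dim (im_pow M j (vpick (val L))) == rkj M j.
Proof.
apply/eqP/dim_im_pow => //; rewrite vpick0 -dimv_eq0.
by case: L => L /= /eqP->.
Qed.

(* [x] |-> im x_M^j, with vpick L a chosen nonzero vector on the line L; the
   value does not depend on the choice (imjE). *)
Definition imj (M : U0module) (hM : GLstable M) (j : nat) (L : Proj elemLie) :
    Gr M (rkj M j) :=
  exist _ (im_pow M j (vpick (val L))) (imj_subproof hM j L).

Lemma im_powZ (M : U0module) j c (x : elemLie) : c != 0 ->
  im_pow M j (c *: x) = im_pow M j x.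
Proof.
move=> c0; have eZ : lfun_exp (lie_op M (c *: x)) j =
    c ^+ j *: lfun_exp (lie_op M x) j :> 'End(M).
  elim: j => [|j IHj]; first by rewrite scale1r.
  rewrite /= IHj -comp_lfunZr exprSr -scalerA; congr (_ *: _).
  rewrite comp_lfunZl; congr (_ \o _)%VF; rewrite /lie_op.
  have -> : lie_incl (c *: x) = c *: lie_incl x + 0.
    rewrite addr0 /lie_incl -linearZ; congr U0proj; rewrite scaler_sumr.
    by apply: eq_bigr => i _; rewrite mxE scalerA.
  rewrite U0act_linear; suff -> : U0act M 0 = 0 by rewrite addr0.
  have := U0act_linear M 1 0 0; rewrite !scale1r addr0 => /eqP.
  by rewrite -subr_eq0 opprD addNKr oppr_eq0 => /eqP.
rewrite /im_pow eZ; have cj0 : c ^+ j != 0 by rewrite expf_neq0.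
have limgZ (f : 'End(M)) d : (limg (d *: f) <= limg f)%VS.
  apply/subvP => _ /memv_imgP[v _ ->].
  by rewrite scale_lfunE -linearZ memv_img ?memvf.
apply/eqP; rewrite eqEsubv limgZ /=.
set f := lfun_exp _ _; have {1}-> : f = (c ^+ j)^-1 *: (c ^+ j *: f).
  by rewrite scalerA mulVf ?scale1r.
exact: limgZ.
Qed.

Lemma imjE (M : U0module) (hM : GLstable M) j (x : elemLie) (L : Proj elemLie) :
  x != 0 -> val L = <[x]>%VS -> val (imj hM j L) = im_pow M j x.
Proof.
move=> x0 LE; rewrite /= LE.
have /vlineP[c cE] := memv_pick <[x]>%VS.
rewrite cE im_powZ //; apply: contraNneq x0 => c0.
by move: cE => /eqP; rewrite c0 scale0r vpick0 -dimv_eq0 dim_vline; case: (x == 0).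
Qed.

End RestrictedEnvelopingAlgebra.

(* Main.v *)
Require Import Defs.
From mathcomp Require Import all_boot all_order all_algebra.

Set Implicit Arguments.
Unset Strict Implicit.
Unset Printing Implicit Defensive.

Import GRing.Theory.
Local Open Scope ring_scope.

(** Stability under GL_r makes the relation "im x_M^j = im y_M^j" invariant
    under GL_r, which acts doubly transitively on the points of the projective
    space.  Hence if two distinct points have the same image, then any two
    points do, and the map is constant. *)

(** Trades an invertible right factor of [pid_mx n] for an invertible left one; used below to absorb
    the row bases of two frames. *)
Lemma unitmx_pid_commute (F : fieldType) (m n : nat) (C : 'M[F]_n) :
  (n <= m)%N -> C \in unitmx ->
  exists2 D : 'M[F]_m, D \in unitmx & D *m pid_mx n = pid_mx n *m C.
Proof.
move=> le_nm uC.
(* The block-diagonal matrix with blocks [E] and the identity of size [m - n]. *)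
pose ext (E : 'M[F]_n) : 'M[F]_m :=
  (pid_mx n : 'M_(m, n)) *m E *m (pid_mx n : 'M_(n, m)) + copid_mx n.
have pidV : (pid_mx n : 'M[F]_(n, m)) *m (pid_mx n : 'M_(m, n)) = 1%:M.
  by rewrite pid_mx_id // pid_mx_1.
have copidr : copid_mx n *m (pid_mx n : 'M[F]_(m, n)) = 0.
  by rewrite mul_copid_mx_pid.
have copidl : (pid_mx n : 'M[F]_(n, m)) *m copid_mx n = 0.
  by rewrite mul_pid_mx_copid.
have ext_pid E : ext E *m (pid_mx n : 'M_(m, n)) = pid_mx n *m E.
  by rewrite mulmxDl copidr addr0 -mulmxA pidV mulmx1.
have ext_copid E : ext E *m copid_mx n = copid_mx n.
  by rewrite mulmxDl -mulmxA copidl mulmx0 add0r copid_mx_id.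
exists (ext C) => //.
(* The product collapses to [pid_mx n + copid_mx n], the identity; for square matrices a one-sided
   inverse suffices. *)
suff /mulmx1_unit[] : ext C *m ext (invmx C) = 1%:M by [].
rewrite {2}/ext mulmxDr ext_copid 2!mulmxA ext_pid -(mulmxA (pid_mx n)).
by rewrite mulmxV // mulmx1 pid_mx_id // addrC subrK.
Qed.

(** Both frames reduce to [pid_mx n] up to invertible factors. The discrepancy between their row
    factors sits on the right and is carried over to the left. *)
Lemma GL_transitive_frames (F : fieldType) (m n : nat) (A B : 'M[F]_(m, n)) :
  \rank A = n -> \rank B = n -> exists2 g, g \in unitmx & g *m A = B.
Proof.
move=> rA rB; have le_nm : (n <= m)%N by rewrite -rA rank_leq_row.
have uC : row_ebase B *m invmx (row_ebase A) \in unitmx.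
  by rewrite unitmx_mul unitmx_inv !row_ebase_unit.
have [D uD DE] := unitmx_pid_commute le_nm uC.
exists (col_ebase B *m D *m invmx (col_ebase A)).
  by rewrite !unitmx_mul unitmx_inv !col_ebase_unit uD.
rewrite -{2}[A]mulmx_ebase -[RHS]mulmx_ebase rA rB -!mulmxA.
rewrite mulKmx ?col_ebase_unit // (mulmxA D) DE -!mulmxA.
by rewrite mulVmx ?row_ebase_unit ?mulmx1.
Qed.

Lemma mxrank_row_mx2 (F : fieldType) (m : nat) (x y : 'cV[F]_m) :
  x != 0 -> y \notin <[x]>%VS -> \rank (row_mx x y) = 2.
Proof.
(* After transposing, it remains to see that a relation [a *: x + b *: y = 0] is trivial; [b != 0]
   would put [y] on the line of [x]. *)
move=> x0 yx; rewrite -mxrank_tr tr_row_mx; apply/eqP/inj_row_free => v.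
rewrite -[v]hsubmxK mul_row_col [lsubmx v]mx11_scalar [rsubmx v]mx11_scalar.
rewrite !mul_scalar_mx -!linearZ -linearD => /(congr1 trmx).
rewrite trmxK trmx0; set a := lsubmx v 0 0; set b := rsubmx v 0 0 => /eqP abE.
have b0 : b = 0.
  apply: contraNeq yx => b0; apply/vlineP; exists (- (b^-1 * a)).
  rewrite addrC addr_eq0 in abE.
  by rewrite scaleNr -scalerA -scalerN -(eqP abE) scalerA mulVf ?scale1r.
move: abE; rewrite b0 scale0r addr0 scaler_eq0 (negPf x0) orbF => /eqP->.
by rewrite raddf0 row_mx0.
Qed.

(** The frames [(x, y)] and [(x, z)] both have rank 2; sharing the first column forces [g] to fix
    [x]. *)
Lemma GL_2transitive (F : fieldType) (m : nat) (x y z : 'cV[F]_m) :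
  x != 0 -> y \notin <[x]>%VS -> z \notin <[x]>%VS ->
  exists2 g, g \in unitmx & g *m x = x /\ g *m y = z.
Proof.
move=> x0 yx zx.
have [g gU] := GL_transitive_frames (mxrank_row_mx2 x0 yx) (mxrank_row_mx2 x0 zx).
by rewrite mul_mx_row => /eq_row_mx; exists g.
Qed.

Lemma Proj_vpick_neq0 (F : fieldType) (V : vectType F) (L : Proj V) :
  vpick (val L) != 0.
Proof. by rewrite vpick0 -dimv_eq0; case: L => L /= /eqP->. Qed.

Lemma Proj_vpickE (F : fieldType) (V : vectType F) (L : Proj V) :
  val L = <[vpick (val L)]>%VS.
Proof.
apply/esym/eqP; rewrite eqEdim -memvE memv_pick dim_vline Proj_vpick_neq0.
by case: L => L /= /eqP->.
Qed.

Lemma Proj_vpick_notin (F : fieldType) (V : vectType F) (L K : Proj V) :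
  L != K -> vpick (val K) \notin <[vpick (val L)]>%VS.
Proof.
apply: contra => KL; rewrite eq_sym; apply/eqP/val_inj/eqP.
rewrite eqEdim [val K]Proj_vpickE [val L]Proj_vpickE -memvE KL.
by rewrite !dim_vline !Proj_vpick_neq0.
Qed.

Theorem proposition3p2p4 (k : closedFieldType) (p : nat)
    (hp : p \in [pchar k]) (r : nat) (M : U0module hp r) (hM : GLstable M)
    (j : nat) (hj : (0 < j < p)%N) :
  ~ (exists W : Gr M (rkj M j), forall L : Proj (elemLie k r), imj hM j L = W) ->
  injective (imj hM j).
Proof.
move=> nconst L1 L2 eq12; apply/eqP/negP => /negP neq12.
case: nconst; exists (imj hM j L1) => L; apply: val_inj => /=.
have [-> //|neq1] := eqVneq L1 L.
(* [g] fixes the representative of [L1] and sends that of [L2] to that of [L]. *)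
have [g gU [gx gy]] := GL_2transitive (Proj_vpick_neq0 L1)
  (Proj_vpick_notin neq12) (Proj_vpick_notin neq1).
have [f _ fE] := im_pow_GL hM gU.
move/(congr1 val): eq12 => /= eq12.
(* The image at [L] is [f] of the image at [L2], hence [f] of the image at [L1], which is the image
   at [L1] since [g] fixes its representative. *)
by rewrite -gy fE -eq12 -fE gx.
Qed.
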